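(* Let $\mu$ be a self-similar measure on $\mathbb{R}$ with $\operatorname{supp}\mu=[0,1]$, and suppose $\mu$ satisfies the weak separation condition with minimal contraction factor $\lambda$. Then $\dim_{qA}\mu<\infty$ if and only if for every $q>1$ and $0<A<B$ there exists a constant $c=c(q,A,B)>0$ such that $$\mu(B(x,A\lambda^n))\geq c\,q^{-n}\mu(B(x,B\lambda^n))$$ for all $n\in\mathbb{N}$ and $x\in\operatorname{supp}\mu$. Equivalently, $\dim_{qA}\mu<\infty$ if and only if for every $\varepsilon>0$ there is a constant $C>0$ such that $$\mu(B(x,r))\geq Cr^\varepsilon\mu(B(x,2r))$$ for all $r\in(0,1)$ and $x\in\operatorname{supp}\mu$.
   Context: $B(x,r)$ denotes the ball of centre $x$ and radius $r$. Self-similar measures. An iterated function system (IFS) is a finite family $\{S_j\}_{j=0}^{m-1}$ of maps $S_j(x)=r_jx+d_j$ on $\mathbb{R}$ with $0<r_j<1$, $d_j\in\mathbb{R}$. Its attractor is the unique non-empty compact set $F$ with $F=\bigcup_j S_j(F)$; here $F=[0,1]$, and the maps are labelled so that $S_0(0)=0$ and $S_{m-1}(1)=1$. Given probabilities $p_j>0$, $\sum_j p_j=1$, the associated self-similar measure $\mu$ is the unique Borel probability measure with $\mu(E)=\sum_j p_j\mu(S_j^{-1}(E))$ for all Borel sets $E$; its support is $[0,1]$. The minimal contraction factor is $\lambda=\min_j r_j$. For a finite word $w=w_1\cdots w_n$ put $S_w=S_{w_1}\circ\cdots\circ S_{w_n}$, $r_w=r_{w_1}\cdots r_{w_n}$,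 $w^-=w_1\cdots w_{n-1}$. For $n\ge 1$, $\Lambda_n$ is the set of finite words $u$ with $r_u\leq\lambda^n$ and $r_{u^-}>\lambda^n$. Weak separation condition (WSC). There is $a>0$ such that for all $n\ge1$, all $u,w\in\Lambda_n$ and each $z\in\{0,1\}$: if $S_u(z)\neq S_w(z)$ then $|S_u(z)-S_w(z)|\geq a\lambda^n$. A self-similar measure satisfies the WSC if its underlying IFS does. Quasi-Assouad dimension. For $\delta\ge0$ let $H(\delta)$ be the infimum of all $s$ for which there exist $C_1,C_2>0$ such that for all $0<r\leq R^{1+\delta}\leq R\leq C_1$, $\sup_{x\in\operatorname{supp}\mu}\frac{\mu(B(x,R))}{\mu(B(x,r))}\leq C_2(R/r)^s$. Then $\dim_{qA}\mu=\lim_{\delta\to0}H(\delta)$. *)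

(* Defs.v *)
From HB Require Import structures.
From mathcomp Require Import all_boot all_order all_algebra.
From mathcomp Require Import all_classical all_reals all_analysis.

Set Implicit Arguments.
Unset Strict Implicit.
Unset Printing Implicit Defensive.

Import Order.TTheory GRing.Theory Num.Theory.
Import numFieldNormedType.Exports.

Local Open Scope classical_set_scope.
Local Open Scope ring_scope.

(* ifs R k has k.+1 maps, so that the family is non-empty. *)
Record ifs (R : realType) (k : nat) := IFS {
  ratio : 'I_k.+1 -> R;
  trans : 'I_k.+1 -> R;
  ratio_gt0 : forall j, 0 < ratio j;
  ratio_lt1 : forall j, ratio j < 1
}.

Section ifs_theory.
Context {R : realType} {k : nat}.
Implicit Type S : ifs R k.

Definition ifs_map S (j : 'I_k.+1) (x : R) : R := ratio S j * x + trans S j.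

Definition is_attractor S (F : set R) : Prop :=
  [/\ F !=set0, compact F & F = \bigcup_(j in [set: 'I_k.+1]) (ifs_map S j @` F)].

Definition min_ratio S : R := \big[Num.min/ratio S ord0]_(j < k.+1) ratio S j.

Definition word_map S (w : seq 'I_k.+1) : R -> R :=
  foldr (fun j f => ifs_map S j \o f) id w.

Definition word_ratio S (w : seq 'I_k.+1) : R := \prod_(j <- w) ratio S j.

Definition word_parent (w : seq 'I_k.+1) : seq 'I_k.+1 := take (size w).-1 w.

(* For n >= 1 the empty word is excluded by the first condition, so the
   junk value word_parent [::] = [::] plays no role. *)
Definition Lambda S (n : nat) : set (seq 'I_k.+1) :=
  [set u | word_ratio S u <= min_ratio S ^+ n /\
           min_ratio S ^+ n < word_ratio S (word_parent u)].

Definition weak_separation S : Prop :=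
  exists2 a : R, 0 < a &
    forall n : nat, (1 <= n)%N ->
    forall u w, Lambda S n u -> Lambda S n w ->
    forall z : R, z = 0 \/ z = 1 ->
      word_map S u z <> word_map S w z ->
      a * min_ratio S ^+ n <= `|word_map S u z - word_map S w z|.

Definition is_self_similar S (p : 'I_k.+1 -> R)
    (mu : probability (measurableTypeR R) R) : Prop :=
  forall E : set (measurableTypeR R), measurable E ->
    mu E = (\sum_(j < k.+1) (p j)%:E * mu (ifs_map S j @^-1` E))%E.

End ifs_theory.

Section dimension.
Context {R : realType}.
Variable mu : probability (measurableTypeR R) R.

Definition supp : set R :=
  [set x | forall U : set R, open U -> U x -> (0 < mu U)%E].

(* The real exponents s admissible in the definition of H(delta). The radius
   written R in the literature is rho here. *)
Definition qA_exponents (delta : R) : set R :=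
  [set s | exists C1 C2 : R, [/\ 0 < C1, 0 < C2 &
     forall r rho : R,
       0 < r -> r <= rho `^ (1 + delta) -> rho `^ (1 + delta) <= rho ->
       rho <= C1 ->
       (ereal_sup [set (fine (mu (ball x rho)) / fine (mu (ball x r)))%:E
                  | x in supp] <= (C2 * (rho / r) `^ s)%:E)%E]].

(* The infimum is taken in the extended reals: it is +oo when no exponent is
   admissible. *)
Definition qA_H (delta : R) : \bar R :=
  ereal_inf [set s%:E | s in qA_exponents delta].

(* Only delta >= 0 is meaningful, so the limit is one-sided. It always exists
   in the extended reals because qA_H is nonincreasing in delta >= 0. *)
Definition qA_dim : \bar R := lim (qA_H delta @[delta --> 0^'+]).

End dimension.

(* Main.v *)
(* Finiteness of the dimension gives doubling up to a factor [r ^ -eps] by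
   comparing the scales [r] and [r ^ (1 / (1 + delta))].  Conversely, at scale
   [lambda ^ n] the weak separation condition leaves at most [K] distinct pieces
   [S_w [0, 1]] meeting [B(x, lambda ^ n)].  The heaviest of them controls the
   mass of the ball; by self-similarity it also gives polynomially large mass to
   small balls centred in the piece.  If the piece is at distance [d > r] from
   [x], almost doubling transfers this mass from [B(x, 2 d)] to [B(x, d)], which
   meets fewer pieces.  Almost doubling is thus used at most [K] times, whatever
   [r] is, which bounds the exponent independently of [delta]. *)
Require Import Defs.
From HB Require Import structures.
From mathcomp Require Import all_boot all_order all_algebra.
From mathcomp Require Import all_classical all_reals all_analysis.
From mathcomp Require Import measurable_realfun ring lra.

Set Implicit Arguments.
Unset Strict Implicit.
Unset Printing Implicit Defensive.

Import Order.TTheory GRing.Theory Num.Theory.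
Import numFieldNormedType.Exports.

Local Open Scope classical_set_scope.
Local Open Scope ring_scope.

Local Notation ratio := Defs.ratio.

(** * Geometric decay and an abstract descent over finitely many weights *)

Lemma exprn_eventually_lt (R : realType) (b t : R) :
  0 <= b -> b < 1 -> 0 < t -> exists N, b ^+ N < t.
Proof.
move=> b0 b1 t0.
have /cvgr0_norm_lt/(_ _ t0)[N _ /(_ N (leqnn N))] : GRing.exp b @ \oo --> 0.
  by apply: cvg_expr; rewrite ger0_norm.
by rewrite /= ger0_norm ?exprn_ge0//; exists N.
Qed.

(* If the heaviest piece meeting the ball of radius [rho] is at distance [e]
   from its centre, then it controls [f rho] by [f (2 e)], hence by [f e], and
   strictly fewer pieces meet the ball of radius [e]. *)
Lemma heaviest_piece_descent (R : realType) (I : finType) (P d : I -> R)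
    (f : R -> R) (r r0 u Q : R) :
  r <= r0 -> 0 < u -> u <= 1 -> 1 <= Q ->
  (forall i, 0 <= P i) -> (forall rho, 0 <= f rho) ->
  (forall rho, rho <= r0 -> f rho <= \sum_(i | d i < rho) P i) ->
  (forall i rho, d i < r0 -> d i <= rho -> r <= rho -> rho <= r0 -> P i * u <= f (2 * rho)) ->
  (forall rho, r <= rho -> rho <= r0 -> f (2 * rho) <= Q * f rho) ->
  f r0 <= (#|I|%:R / u * Q) ^+ #|I| * f r.
Proof.
move=> r_le u0 u1 Q1 P0 f0 f_cover f_lower f_doubling.
set W := _ * Q.
have u_inv : 1 <= u^-1 by rewrite invf_ge1.
have W0 : 0 <= W.
  by rewrite mulr_ge0 ?mulr_ge0 ?(le_trans ler01 u_inv) ?(le_trans ler01 Q1).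
suff descent m : forall rho, r <= rho -> rho <= r0 ->
    (#|[pred i | (d i < rho)%R]| <= m)%N -> f rho <= W ^+ m * f r.
  by apply: descent => //; exact: max_card.
elim: m => [|m IH] rho r_rho rho_r0 card_m.
  rewrite expr0 mul1r (le_trans (f_cover _ rho_r0))// big_pred0 ?f0// => i.
  by move: card_m; rewrite leqn0 => /eqP/card0_eq/(_ i).
case: (pickP (fun i => d i < rho)) => [i1 i1P|none]; last first.
  rewrite (le_trans (f_cover _ rho_r0))// big_pred0 ?mulr_ge0 ?exprn_ge0//.
case: (@arg_maxP _ _ _ i1 (fun i => d i < rho) P i1P) => i iP i_max.
have W1 : 1 <= W.
  have I1 : (1 : R) <= #|I|%:R by rewrite ler1n (cardD1 i).
  by rewrite /W !mulr_ege1.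
have f_P : f rho <= #|I|%:R * P i.
  rewrite (le_trans (f_cover _ rho_r0))//.
  rewrite (le_trans (ler_sum _ i_max))// sumr_const -[leLHS]mulr_natl ler_wpM2r//.
  by rewrite ler_nat max_card.
have f_f e : d i <= e -> r <= e -> e <= r0 -> f rho <= W * f e.
  move=> de re er0.
  have := f_lower i e (lt_le_trans iP rho_r0) de re er0.
  rewrite -ler_pdivlMr// => Pf.
  rewrite (le_trans f_P)// /W -!mulrA ler_wpM2l// (le_trans Pf)//.
  by rewrite mulrC ler_wpM2l ?invr_ge0 ?f_doubling// ltW.
rewrite exprS -mulrA.
(* If the heaviest piece lies within [r], one application reaches radius [r] at once. Otherwise
   [rho] drops to [d i], where the strict inequality defining the count no longer admits [i]. *)
have [d_r|r_d] := leP (d i) r.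
  rewrite (le_trans (f_f r _ _ _))// ler_wpM2l// -[leLHS]mul1r.
  by rewrite ler_wpM2r// exprn_ege1.
have d_r0 := lt_le_trans iP rho_r0.
apply: le_trans (f_f (d i) (lexx _) (ltW r_d) (ltW d_r0)) _.
rewrite ler_wpM2l// IH//; [exact: ltW|exact: ltW|].
rewrite -ltnS (leq_trans _ card_m)// proper_card//; apply/properP; split.
  by apply/fintype.subsetP => j; rewrite !inE => /lt_trans; apply.
by exists i; rewrite !inE// ltxx.
Qed.

(** * Contraction ratios and affine word maps *)

Section ifs_basics.
Context {R : realType} {k : nat} (S : ifs R k).
Local Notation lambda := (min_ratio S).

Lemma min_ratio_le j : lambda <= ratio S j.
Proof. by rewrite /min_ratio; apply: bigmin_le_cond. Qed.

Lemma min_ratio_gt0 : 0 < lambda.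
Proof. by apply/bigmin_gtP; split=> [|? _]; exact: ratio_gt0. Qed.

Lemma min_ratio_lt1 : lambda < 1.
Proof. exact: le_lt_trans (min_ratio_le ord0) (ratio_lt1 S ord0). Qed.

Lemma ratio_bound : exists b : R, [/\ 0 < b, b < 1 & forall j, ratio S j <= b].
Proof.
exists (\big[Num.max/ratio S ord0]_j ratio S j); split.
- by rewrite (lt_le_trans (ratio_gt0 S ord0))// bigmax_ge_id.
- by apply/bigmax_ltP; split=> [|? _]; exact: ratio_lt1.
- by move=> j; apply: le_bigmax_cond.
Qed.

Lemma word_ratio_cons j w : word_ratio S (j :: w) = ratio S j * word_ratio S w.
Proof. by rewrite /word_ratio big_cons. Qed.

Lemma word_ratio_gt0 w : 0 < word_ratio S w.
Proof. by apply: prodr_gt0 => j _; exact: ratio_gt0. Qed.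

Lemma word_mapE w y : word_map S w y = word_ratio S w * y + word_map S w 0.
Proof.
elim: w y => [|j w IH] y; first by rewrite /word_ratio big_nil mul1r addr0.
rewrite word_ratio_cons /= /ifs_map IH; ring.
Qed.

(** An affine map is determined by two values. This is why separation of the images of 0 and 1 alone
    is enough to tell pieces apart. *)
Lemma word_map_inj w w' :
  word_map S w 0 = word_map S w' 0 -> word_map S w 1 = word_map S w' 1 ->
  word_map S w = word_map S w'.
Proof.
move=> e0 e1; apply/funext => y; move: e1.
rewrite (word_mapE w 1) (word_mapE w' 1) (word_mapE w y) (word_mapE w' y) e0.
by move=> /addIr; rewrite !mulr1 => ->.
Qed.

Lemma measurable_word_preimage w (E : set (measurableTypeR R)) :
  measurable E -> measurable (word_map S w @^-1` E).
Proof.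
move=> mE; rewrite -[X in measurable X]setTI.
suff: measurable_fun [set: measurableTypeR R]
    (word_map S w : measurableTypeR R -> measurableTypeR R) by apply.
rewrite (_ : word_map S w = fun y => word_ratio S w * y + word_map S w 0); last first.
  by apply/funext => y; exact: word_mapE.
by apply: measurable_funD => //; exact: measurable_funM.
Qed.

Lemma measurable_ifs_preimage j (E : set (measurableTypeR R)) :
  measurable E -> measurable (ifs_map S j @^-1` E).
Proof. exact: (@measurable_word_preimage [:: j]). Qed.

End ifs_basics.

(** Each point off the support lies in a null open interval with rational endpoints, and there are
    only countably many such intervals. *)
Lemma mu_setC_supp (R : realType) (mu : probability (measurableTypeR R) R)
    (E : set (measurableTypeR R)) :
  measurable E -> E `&` supp mu = set0 -> mu E = 0%E.
Proof.
move=> mE E_supp; apply: measure_negligible => //.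
pose null_itv (ab : option (rat * rat)) : set (measurableTypeR R) :=
  if ab is Some (a, b)
  then if mu `]ratr a, ratr b[%classic == 0%E then `]ratr a, ratr b[%classic else set0
  else set0.
apply: (@negligibleS _ _ _ _ (\bigcup_n null_itv (unpickle n))); last first.
  apply: negligible_bigcup => n; apply/negligibleP; case: unpickle => [[a b]|] //=.
    by case: ifP.
  by case: ifP => [/eqP|].
move=> y Ey.
have : ~ supp mu y by move=> sy; rewrite -[False]/(set0 y) -E_supp.
move=> /existsNP[U] /not_implyP[oU] /not_implyP[Uy] /negP; rewrite -leNgt => mU0.
have [e e0 yU] : exists2 e : R, 0 < e & ball y e `<=` U.
  by have /nbhs_ballP := open_nbhs_nbhs (conj oU Uy).
have [a] := @rat_in_itvoo R (y - e) y ltac:(lra).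
have [b] := @rat_in_itvoo R y (y + e) ltac:(lra).
rewrite !in_itv /= => /andP[yb bye] /andP[yea ay].
exists (pickle (a, b)); first by [].
rewrite pickleK /= ifT /= ?in_itv /= ?ay ?yb//.
rewrite -measure_le0 (le_trans _ mU0)// le_measure ?inE//; first exact: open_measurable.
apply: subset_trans yU => z /=; rewrite in_itv /= => /andP[az zb].
by rewrite /ball /= ltr_norml; lra.
Qed.

(** * Masses of balls and cylinders for a self-similar measure *)

Section self_similar_measure.
Context {R : realType} {k : nat} (S : ifs R k) (p : 'I_k.+1 -> R).
Context (mu : probability (measurableTypeR R) R).
Context (S_attractor : is_attractor S `[0, 1]%classic).
Context (p_gt0 : forall j, 0 < p j).
Context (mu_self_similar : is_self_similar S p mu).
Context (mu_supp : supp mu = `[0, 1]%classic).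
Implicit Types E : set (measurableTypeR R).
Local Notation lambda := (min_ratio S).
Local Notation mass E := (fine (mu E)).

Lemma supp_unit x : supp mu x <-> 0 <= x <= 1.
Proof. by rewrite mu_supp /= in_itv. Qed.

Lemma mu_mass E : measurable E -> mu E = (mass E)%:E.
Proof. by move=> mE; rewrite fineK// fin_num_measure. Qed.

Lemma mass_ge0 E : 0 <= mass E.
Proof. exact: fine_ge0. Qed.

Lemma le_mass E E' : measurable E -> measurable E' -> E `<=` E' -> mass E <= mass E'.
Proof.
by move=> mE mE' EE'; rewrite -lee_fin -!mu_mass// le_measure ?inE.
Qed.

Lemma mass_le1 E : measurable E -> mass E <= 1.
Proof. by move=> mE; rewrite -lee_fin -mu_mass// probability_le1. Qed.

Lemma le_mass_ball x r r' : r <= r' -> mass (ball x r) <= mass (ball x r').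
Proof.
by move=> rr'; apply: le_mass; [exact: measurable_ball..|exact: le_ball].
Qed.

Lemma mass_disjoint_unit E :
  measurable E -> (forall y, 0 <= y <= 1 -> ~ E y) -> mass E = 0.
Proof.
move=> mE E01; rewrite mu_setC_supp// -subset0 => y [Ey /supp_unit y01].
exact: E01 Ey.
Qed.

Lemma mass_cover_unit E :
  measurable E -> (forall y, 0 <= y <= 1 -> E y) -> mass E = 1.
Proof.
move=> mE E01.
have : mu (~` E) = 0%E.
  apply: mu_setC_supp; first exact: measurableC.
  by rewrite -subset0 => y [nEy /supp_unit /E01].
by rewrite probability_setC// mu_mass// -EFinB => -[]/eqP; rewrite subr_eq0 => /eqP.
Qed.

Lemma unit_ifs_map x : 0 <= x <= 1 -> exists j y, 0 <= y <= 1 /\ x = ifs_map S j y.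
Proof.
move=> x01; case: S_attractor => _ _ S01.
have : `[0, 1]%classic x by rewrite /= in_itv.
rewrite S01 => -[j _ [y]]; rewrite /= in_itv /= => y01 <-.
by exists j, y.
Qed.

Lemma mass_ifs E : measurable E -> mass E = \sum_j p j * mass (ifs_map S j @^-1` E).
Proof.
move=> mE; rewrite mu_self_similar// (eq_bigr (fun j => (p j * mass (ifs_map S j @^-1` E))%:E)).
  by rewrite sumEFin.
by move=> j _; rewrite (mu_mass (measurable_ifs_preimage S j mE)).
Qed.

(** A common bound [b < 1] for the ratios has a power below the smallest weight, so one exponent
    serves all [j]. It lets weights be traded for powers of the radius. *)
Lemma exprn_ratio_le_weight : exists s : nat, forall j, ratio S j ^+ s <= p j.
Proof.
have [b [b0 b1 rb]] := ratio_bound S.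
have [s bs] : exists s, b ^+ s < \big[Num.min/p ord0]_j p j.
  apply: exprn_eventually_lt => //; first exact: ltW.
  by apply/bigmin_gtP; split=> [|? _]; exact: p_gt0.
exists s => j; apply: (@le_trans _ _ (b ^+ s)).
  by rewrite lerXn2r ?nnegrE ?(ltW b0) ?(ltW (ratio_gt0 S j)).
by rewrite (le_trans (ltW bs))// bigmin_le_cond.
Qed.

(* The pieces are followed down to scale [t]; at each step [p j] absorbs the
   factor [ratio S j ^+ s] lost in the rescaling. *)
Lemma mass_ball_lower : exists s : nat, forall z t : R,
  0 <= z <= 1 -> 0 < t -> lambda * t <= 1 -> (lambda * t) ^+ s <= mass (ball z t).
Proof.
have [s ps] := exprn_ratio_le_weight.
have [b [b0 b1 rb]] := ratio_bound S.
have l0 := min_ratio_gt0 S.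
exists s => z t z01 t0 lt1.
have [N] := exprn_eventually_lt (ltW b0) b1 t0.
(* Pulling back by a map divides [t] by a ratio at most [b], which lowers [N] by one. The condition
   is [lambda * t <= 1] and not [t <= 1] because a radius [t <= 1] may grow up to [1 / lambda] in
   this step. *)
elim: N z t z01 t0 lt1 => [|N IH] z t z01 t0 lt1 bNt.
  rewrite mass_cover_unit ?exprn_ile1//; [by nra|exact: measurable_ball|].
  by move=> y y01; rewrite /ball /= ltr_norml; rewrite expr0 in bNt; lra.
have [t1|t1] := ltP 1 t.
  rewrite mass_cover_unit ?exprn_ile1//; [by nra|exact: measurable_ball|].
  by move=> y y01; rewrite /ball /= ltr_norml; lra.
have [j [y [y01 ->]]] := unit_ifs_map z01.
have r0 := ratio_gt0 S j; have rj := rb j; have lr := min_ratio_le S j.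
rewrite mass_ifs; last exact: measurable_ball.
rewrite (bigD1 j)//= -[leLHS]addr0 lerD//; last first.
  by apply: sumr_ge0 => i _; rewrite mulr_ge0 ?mass_ge0 ?(ltW (p_gt0 i)).
rewrite (_ : _ @^-1` _ = ball y (t / ratio S j)); last first.
  apply/funext => v; apply/propext; rewrite /ball /ifs_map /=.
  rewrite opprD addrACA subrr addr0 -mulrBr normrM gtr0_norm//.
  by rewrite ltr_pdivlMr// mulrC.
rewrite (_ : lambda * t = ratio S j * (lambda * (t / ratio S j))); last first.
  by field; lra.
rewrite exprMn ler_pM ?exprn_ge0//; [by lra|by rewrite !mulr_ge0 ?invr_ge0//; lra|].
apply: IH => //; first exact: divr_gt0.
  by rewrite mulrA ler_pdivrMr//; nra.
rewrite ltr_pdivlMr// (le_lt_trans _ bNt)// exprSr ler_wpM2l// exprn_ge0//.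
exact: ltW.
Qed.

Lemma mass_ball_gt0 (x t : R) : 0 <= x <= 1 -> 0 < t -> 0 < mass (ball x t).
Proof.
move=> x01 t0; rewrite -lte_fin -mu_mass; last exact: measurable_ball.
have /supp_unit := x01; apply; first exact: ball_open.
exact: ballxx.
Qed.

(** The self-similarity identity is expanded along every branch until the ratio first drops to [t].
    For [t = lambda ^+ n] the words obtained lie in [Lambda S n]. *)
Lemma cylinder_decomposition (t : R) : 0 < t -> t < 1 ->
  exists L : seq (seq 'I_k.+1),
    (forall w, w \in L -> word_ratio S w <= t /\ t < word_ratio S (word_parent w)) /\
    (forall E, measurable E ->
      mass E = \sum_(w <- L) (\prod_(j <- w) p j) * mass (word_map S w @^-1` E)).
Proof.
move=> t0 t1.
have [b [b0 b1 rb]] := ratio_bound S.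
(* The induction must admit the empty word: the rescaled threshold [t / ratio S j] may be at least
   1, and then [[:: [::]]] is the list. For [t < 1] the bound on the ratio rules the empty word out
   again. *)
suff : exists L : seq (seq 'I_k.+1),
    (forall w, w \in L -> word_ratio S w <= t /\
      (w != [::] -> t < word_ratio S (word_parent w))) /\
    (forall E, measurable E ->
      mass E = \sum_(w <- L) (\prod_(j <- w) p j) * mass (word_map S w @^-1` E)).
  move=> [L [HL EL]]; exists L; split => // w /HL[wt tw]; split => //; move: wt tw.
  case: w => [|j w] wt; last by apply.
  by move: wt; rewrite /word_ratio big_nil; lra.
clear t1; have [N] := exprn_eventually_lt (ltW b0) b1 t0.
have base (u : R) : 1 <= u -> exists L : seq (seq 'I_k.+1),
    (forall w, w \in L -> word_ratio S w <= u /\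
      (w != [::] -> u < word_ratio S (word_parent w))) /\
    (forall E, measurable E ->
      mass E = \sum_(w <- L) (\prod_(j <- w) p j) * mass (word_map S w @^-1` E)).
  move=> u1; exists [:: [::]]; split.
    by move=> w; rewrite inE => /eqP ->; rewrite /word_ratio big_nil.
  by move=> E mE; rewrite big_seq1 big_nil mul1r.
elim: N t t0 => [|N IH] t t0 bNt; first by apply: base; rewrite ltW.
have [t1|t1] := leP 1 t; first exact: base.
have /choice[L HL] : forall j, exists L : seq (seq 'I_k.+1),
    (forall w, w \in L -> word_ratio S w <= t / ratio S j /\
      (w != [::] -> t / ratio S j < word_ratio S (word_parent w))) /\
    (forall E, measurable E ->
      mass E = \sum_(w <- L) (\prod_(j <- w) p j) * mass (word_map S w @^-1` E)).
  move=> j; have r0 := ratio_gt0 S j; apply: IH; first exact: divr_gt0.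
  rewrite ltr_pdivlMr// (le_lt_trans _ bNt)// exprSr ler_wpM2l// exprn_ge0//.
  exact: ltW.
(* Stopping [j :: w] at threshold [t] amounts to stopping [w] at threshold [t / ratio S j]. *)
exists (flatten [seq [seq j :: w | w <- L j] | j <- index_enum 'I_k.+1]); split.
  move=> w /flatten_mapP[j _ /mapP[v vL ->]] {w}.
  have r0 := ratio_gt0 S j.
  have [/(_ v vL)[vt tv] _] := HL j.
  rewrite word_ratio_cons mulrC -ler_pdivlMr//; split => // _.
  case: v vt tv {vL} => [|i v] vt tv; first by rewrite /word_parent /word_ratio big_nil.
  by rewrite /word_parent /= word_ratio_cons mulrC -ltr_pdivrMr// tv.
move=> E mE; rewrite mass_ifs// big_flatten big_map; apply: eq_bigr => j _.
rewrite big_map (proj2 (HL j)); last exact: measurable_ifs_preimage.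
by rewrite mulr_sumr; apply: eq_bigr => w _; rewrite big_cons mulrA.
Qed.

End self_similar_measure.

Lemma truncn_eq_dist (R : archiRealFieldType) (g g' : R) :
  0 <= g -> 0 <= g' -> Num.truncn g = Num.truncn g' -> `|g - g'| < 1.
Proof.
move=> /truncn_itv/andP[g1 g2] /truncn_itv/andP[g3 g4] e.
by rewrite e in g1 g2; rewrite ltr_norml; rewrite -natr1 in g2 g4; lra.
Qed.

(** * Weak separation and the pieces near a ball *)

Section descent.
Context {R : realType} {k : nat} (S : ifs R k).
Local Notation lambda := (min_ratio S).

(** This is the distance from [x] to the interval with endpoints [word_map S w 0] and
    [word_map S w 1]. *)
Definition piece_dist (x : R) w :=
  Num.max 0 (Num.max (word_map S w 0 - x) (x - word_map S w 1)).

Lemma piece_dist_le x w y : 0 <= y <= 1 -> piece_dist x w <= `|x - word_map S w y|.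
Proof.
move=> /andP[y0 y1]; rewrite /piece_dist !ge_max normr_ge0 /=.
have w0 := word_ratio_gt0 S w.
rewrite (word_mapE S w 1) (word_mapE S w y).
apply/andP; split.
  by rewrite distrC (le_trans _ (ler_norm _))//; nra.
by rewrite (le_trans _ (ler_norm _))//; nra.
Qed.

Lemma piece_dist_attained x w :
  exists y, 0 <= y <= 1 /\ `|x - word_map S w y| <= piece_dist x w.
Proof.
have w0 := word_ratio_gt0 S w.
have w1 := word_mapE S w 1.
have : 0 <= piece_dist x w by rewrite le_max lexx.
have : word_map S w 0 - x <= piece_dist x w by rewrite !le_max lexx /= orbT.
have : x - word_map S w 1 <= piece_dist x w by rewrite !le_max lexx !orbT.
move: (piece_dist x w) => d d1 d0 d_ge0.
have [x0|x0] := leP x (word_map S w 0).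
  by exists 0; split; [lra|rewrite ler_norml; lra].
have [x1|x1] := leP (word_map S w 1) x.
  by exists 1; split; [lra|rewrite ler_norml; lra].
exists ((x - word_map S w 0) / word_ratio S w); split.
  by rewrite divr_ge0 ?ler_pdivrMr//; lra.
by rewrite word_mapE mulrC divfK ?gt_eqF// subrK subrr normr0.
Qed.

(** The two endpoints of a piece are located on a grid of mesh [h] starting at [x]. The finite
    codomain makes counting pieces a matter of its cardinality. *)
Definition piece_cell M (h x : R) (w : seq 'I_k.+1) : 'I_M.+1 * 'I_M.+1 :=
  let cell z := inord (Num.truncn ((word_map S w z - x) / h)) in (cell 0, cell 1).

(** Two endpoints in one cell differ by less than [h], so separation forces them to coincide. The
    range hypothesis keeps [inord] away from its default value. *)
Lemma piece_cell_inj M (h x : R) w w' : 0 < h ->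
  (forall v z, v = w \/ v = w' -> z = 0 \/ z = 1 ->
     0 <= (word_map S v z - x) / h < M.+1%:R) ->
  (forall z, z = 0 \/ z = 1 -> word_map S w z <> word_map S w' z ->
     h <= `|word_map S w z - word_map S w' z|) ->
  piece_cell M h x w = piece_cell M h x w' -> word_map S w = word_map S w'.
Proof.
move=> h0 bnd sep [c0 c1].
have same z : z = 0 \/ z = 1 ->
    inord (Num.truncn ((word_map S w z - x) / h)) =
      inord (Num.truncn ((word_map S w' z - x) / h)) :> 'I_M.+1 ->
    word_map S w z = word_map S w' z.
  move=> z01.
  have /andP[g0 gM] := bnd w z (or_introl erefl) z01.
  have /andP[g0' gM'] := bnd w' z (or_intror erefl) z01.
  move=> /(congr1 val); rewrite /= !inordK ?truncn_lt_nat// => /truncn_eq_dist.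
  move=> /(_ g0 g0'); rewrite -mulrBl opprB addrA subrK normrM normfV (gtr0_norm h0).
  rewrite ltr_pdivrMr// mul1r ltNge => /negP lt_h.
  by apply: contrapT => /(sep z z01).
by apply: word_map_inj; apply: same => //; [left|right].
Qed.

Context (p : 'I_k.+1 -> R) (mu : probability (measurableTypeR R) R).
Context (S_attractor : is_attractor S `[0, 1]%classic).
Context (p_gt0 : forall j, 0 < p j) (mu_self_similar : is_self_similar S p mu).
Context (mu_supp : supp mu = `[0, 1]%classic) (S_wsc : weak_separation S).
Local Notation mass E := (fine (mu E)).

(* [K] bounds the number of distinct maps [word_map S w], with [w] in
   [Lambda S n], whose pieces meet a given ball of radius [lambda ^+ n]. *)
Lemma mass_ball_descent : exists K s : nat, forall n (x r Q : R), (0 < n)%N ->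
  0 < r -> r <= lambda ^+ n -> 1 <= Q ->
  (forall rho : R, r <= rho -> rho <= lambda ^+ n ->
     mass (ball x (2 * rho)) <= Q * mass (ball x rho)) ->
  mass (ball x (lambda ^+ n)) <=
    (K%:R / (lambda * (r / lambda ^+ n)) ^+ s * Q) ^+ K * mass (ball x r).
Proof.
have [a a0 wsc] := S_wsc.
have [s lower] := mass_ball_lower S_attractor p_gt0 mu_self_similar mu_supp.
(* A piece of length at most [R0] at distance less than [R0] from [x] has both endpoints within
   [2 * R0] of [x]. A window of length [4 * R0] is thus cut into cells of length [a * R0]. *)
pose M := Num.truncn (4 / a).
exists #|{: 'I_M.+1 * 'I_M.+1}|, s => n x r Q n0 r0 rR Q1 doubling.
have l0 := min_ratio_gt0 S; have l1 := min_ratio_lt1 S.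
set R0 := lambda ^+ n in rR doubling *.
have R00 : 0 < R0 by rewrite exprn_gt0.
have R01 : R0 < 1 by rewrite exprn_ilt1 ?ltW// -lt0n.
have [L [L_Lambda L_mass]] :=
  cylinder_decomposition mu_self_similar R00 R01.
set h := a * R0; have h0 : 0 < h by rewrite mulr_gt0.
pose cell := piece_cell M h (x - 2 * R0).
(* Many words may code the same piece. A fiber gathers such words, so that its total weight is the
   weight of one geometric piece and the number of fibers does not depend on [n]. *)
pose fiber i := [seq w <- L | (cell w == i) && (piece_dist x w < R0)].
pose pw (w : seq 'I_k.+1) := \prod_(j <- w) p j.
have pw0 w : 0 <= pw w by apply: prodr_ge0 => j _; exact: ltW.
have fiberP i w : w \in fiber i -> [/\ w \in L, cell w = i & piece_dist x w < R0].
  by rewrite mem_filter => /andP[/andP[/eqP ? ?] ?].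
have fiber_map i w w' : w \in fiber i -> w' \in fiber i -> word_map S w = word_map S w'.
  move=> wi wi'; have [wL cw dw] := fiberP _ _ wi; have [wL' cw' dw'] := fiberP _ _ wi'.
  apply: (@piece_cell_inj M h (x - 2 * R0)) => //; last by rewrite -/(cell w) cw.
  - move=> v z vw z01.
    have {vw wL' dw' wL dw}[vL dv] : v \in L /\ piece_dist x v < R0 by case: vw => ->.
    have [v_le _] := L_Lambda _ vL.
    move: dv; rewrite /piece_dist !gt_max => /and3P[_].
    have v0 := word_ratio_gt0 S v.
    rewrite (word_mapE S v z) (word_mapE S v 1) => d0 d1.
    have up : (word_ratio S v * z + word_map S v 0 - (x - 2 * R0)) / h < 4 / a.
      rewrite /h invfM mulrA -mulrAC ltr_pM2r ?invr_gt0// ltr_pdivrMr//.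
      by case: z01 => ->; lra.
    apply/andP; split; last by rewrite (lt_trans up)// /M truncnS_gt.
    by rewrite divr_ge0//; [case: z01 => ->; lra|exact: ltW].
  - by move=> z z01; apply: wsc => //; exact: L_Lambda.
set u := (lambda * (r / R0)) ^+ s.
have rR1 : 0 < r / R0 <= 1 by rewrite divr_gt0//= ler_pdivrMr// mul1r.
have lr1 : 0 < lambda * (r / R0) <= 1 by nra.
(* The first word of a fiber represents its piece. An empty fiber has weight 0, whatever the
   distance of the default word [[::]]. *)
apply: (@heaviest_piece_descent _ _ (fun i => \sum_(w <- fiber i) pw w)
  (fun i => piece_dist x (head [::] (fiber i))) (fun rho => mass (ball x rho))) => //.
- by rewrite exprn_gt0//; case/andP: lr1.
- by rewrite exprn_ile1//; case/andP: lr1 => /ltW.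
- by move=> i; apply: sumr_ge0.
- by move=> rho; exact: mass_ge0.
- move=> rho rhoR; rewrite L_mass; last exact: measurable_ball.
  apply: (@le_trans _ _ (\sum_(w <- L | piece_dist x w < rho) pw w)).
    rewrite [leRHS]big_mkcond; apply: ler_sum => w _; case: ltP => dw.
      rewrite -[leRHS]mulr1 ler_wpM2l ?pw0// mass_le1//.
      by apply: measurable_word_preimage; exact: measurable_ball.
    rewrite (mass_disjoint_unit mu_supp) ?mulr0//.
      by apply: measurable_word_preimage; exact: measurable_ball.
    move=> y /(piece_dist_le x w); rewrite /ball /= leNgt => /negP far xy.
    exact: far (lt_le_trans xy dw).
  rewrite (partition_big cell predT)//= [leRHS]big_mkcond; apply: ler_sum => i _.
  case: ltP => di.
    rewrite big_filter big_mkcond [leRHS]big_mkcond; apply: ler_sum => w _.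
    case: ifP => [/andP[dw ->]|_]; first by rewrite (lt_le_trans dw).
    by case: ifP.
  rewrite big_seq_cond big_pred0// => w; apply/negP => /and3P[wL dw cw].
  have wi : w \in fiber i by rewrite mem_filter cw wL (lt_le_trans dw).
  have hi : head [::] (fiber i) \in fiber i by case: (fiber i) wi => // v t _; exact: mem_head.
  by move: dw; rewrite ltNge /piece_dist (fiber_map _ _ _ wi hi) di.
- move=> i rho di d_rho r_rho rhoR.
  case: (fiber i =P [::]) => [->|/eqP i0]; first by rewrite big_nil mul0r mass_ge0.
  have hi : head [::] (fiber i) \in fiber i by case: (fiber i) i0 => // v t _; exact: mem_head.
  have [y [y01 xy]] := piece_dist_attained x (head [::] (fiber i)).
  rewrite L_mass; last exact: measurable_ball.
  rewrite mulr_suml big_filter big_mkcond big_seq [leRHS]big_seq.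
  apply: ler_sum => w wL; case: ifP => [cdw|_]; last first.
    by rewrite mulr_ge0 ?pw0// mass_ge0.
  have wi : w \in fiber i by rewrite mem_filter cdw.
  rewrite ler_wpM2l ?pw0//.
  (* Since the ratio of [w] is at most [R0], the ball of radius [r / R0] about [y] is mapped within
     [r <= rho] of a point that is itself within [rho] of [x]. *)
  apply: (@le_trans _ _ (mass (ball y (r / R0)))).
    by apply: lower => //; [case/andP: rR1|case/andP: lr1].
  apply: le_mass; first exact: measurable_ball.
    by apply: measurable_word_preimage; exact: measurable_ball.
  move=> v; rewrite /ball /= => yv.
  rewrite (fiber_map _ _ _ hi wi) in xy d_rho.
  have w0 := word_ratio_gt0 S w; have [wR _] := L_Lambda w wL.
  have step : `|word_map S w y - word_map S w v| < r.
    rewrite (word_mapE S w y) (word_mapE S w v) opprD addrACA subrr addr0.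
    rewrite -mulrBr normrM gtr0_norm//.
    rewrite (le_lt_trans (y := R0 * `|y - v|)) ?ler_wpM2r//.
    by rewrite mulrC -ltr_pdivlMr.
  rewrite -(subrKA (word_map S w y)) (le_lt_trans (ler_normD _ _))//.
  have -> : 2 * rho = rho + rho by ring.
  rewrite ler_ltD//; last exact: lt_le_trans step _.
  exact: le_trans xy d_rho.
Qed.

End descent.

Lemma exprn_bracket (R : realType) (l t : R) : 0 < l -> l < 1 -> 0 < t -> t <= 1 ->
  exists n, l ^+ n.+1 < t /\ t <= l ^+ n.
Proof.
move=> l0 l1 t0 t1; have exN := exprn_eventually_lt (ltW l0) l1 t0.
case: (ex_minnP exN) => -[|n] ltn n_min.
  by move: ltn; rewrite expr0 ltNge t1.
by exists n; split => //; rewrite leNgt; apply/negP => /n_min; rewrite ltnn.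
Qed.

Lemma powR_invK (R : realType) (y e : R) : 0 <= y -> e != 0 -> (y `^ e) `^ e^-1 = y.
Proof. by move=> y0 e0; rewrite -powRrM divff// powRr1. Qed.

Lemma gt0_powRD (R : realType) (y e e' : R) : 0 < y -> y `^ (e + e') = y `^ e * y `^ e'.
Proof. by move=> y0; rewrite powRD// (gt_eqF y0) implybT. Qed.

(** * The quasi-Assouad dimension as a supremum over [delta] *)

Section quasi_assouad.
Context {R : realType} (mu : probability (measurableTypeR R) R).

Lemma qA_exponentsS (delta delta' : R) : 0 < delta -> delta <= delta' ->
  qA_exponents mu delta `<=` qA_exponents mu delta'.
Proof.
move=> d0 dd' s [C1 [C2 [C10 C20 bound]]]; exists C1, C2; split => // r rho r0 r_rho rho_rho rhoC.
have rho0 : 0 < rho by lra.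
have rho1 : rho <= 1.
  rewrite leNgt; apply/negP => rho1; move: rho_rho; apply/negP; rewrite -ltNge.
  rewrite -[ltLHS]powRr1 ?ltW// /powR gt_eqF// ltr_expR ltr_pM2r ?ln_gt0//; lra.
have rho01 : 0 < rho <= 1 by rewrite rho0.
apply: bound => //; last by apply: ge1r_powR => //; lra.
by rewrite (le_trans r_rho)// ger_powR//; lra.
Qed.

(** By monotonicity in [delta], the right limit at 0 is a supremum. *)
Lemma qA_dimE : qA_dim mu = ereal_sup (qA_H mu @` `]0, +oo[%classic).
Proof.
apply: cvg_lim => //.
apply: (@nonincreasing_at_right_cvge R (qA_H mu) 0 +oo%O) => //.
move=> d d'; rewrite !in_itv /= !andbT => d0 _ dd'.
by apply: le_ereal_inf; apply: image_subset; exact: qA_exponentsS.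
Qed.

(** The order of quantifiers matters: [D] is fixed first, so [delta] can afterwards be chosen in
    terms of [D]. *)
Lemma qA_exponent_of_dim : (qA_dim mu < +oo)%E ->
  exists2 D : R, 0 < D &
    forall delta, 0 < delta -> exists2 s, s <= D & qA_exponents mu delta s.
Proof.
move=> dim_fin.
have [D D0 dimD] : exists2 D : R, 0 < D & (qA_dim mu < D%:E)%E.
  case: (qA_dim mu) dim_fin => [d|//|] _; last by exists 1; rewrite ?ltNye.
  exists (Num.max d 0 + 1); rewrite ?lte_fin.
    by rewrite ltr_wpDl// le_max lexx orbT.
  by rewrite ltr_pwDr// le_max lexx.
exists D => // delta delta0.
have : (qA_H mu delta < D%:E)%E.
  apply: le_lt_trans dimD; rewrite qA_dimE; apply: ereal_sup_ubound.
  by exists delta => //=; rewrite in_itv /= andbT.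
by move=> /ereal_inf_lt[_ [s sE <-]]; rewrite lte_fin => /ltW sD; exists s.
Qed.

Lemma qA_dim_le (D : R) :
  (forall delta, 0 < delta -> qA_exponents mu delta D) -> (qA_dim mu <= D%:E)%E.
Proof.
move=> HD; rewrite qA_dimE; apply: ub_ereal_sup => h [d /=].
rewrite in_itv /= andbT => d0 <-; apply: ereal_inf_lbound.
by exists D => //; exact: HD.
Qed.

End quasi_assouad.

(** * Doubling conditions and finiteness of the dimension *)

Section characterization.
Context {R : realType} {k : nat} (S : ifs R k) (p : 'I_k.+1 -> R).
Context (mu : probability (measurableTypeR R) R).
Context (S_attractor : is_attractor S `[0, 1]%classic).
Context (p_gt0 : forall j, 0 < p j) (mu_self_similar : is_self_similar S p mu).
Context (mu_supp : supp mu = `[0, 1]%classic).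
Local Notation lambda := (min_ratio S).
Local Notation mass E := (fine (mu E)).

Lemma mu_ball_le c x r x' r' : (c%:E * mu (ball x r) <= mu (ball x' r'))%E =
  (c * mass (ball x r) <= mass (ball x' r')).
Proof.
by rewrite (mu_mass mu (measurable_ball x r)) (mu_mass mu (measurable_ball x' r')) -EFinM lee_fin.
Qed.

Definition subexponential_doubling : Prop := forall q A B : R, 1 < q -> 0 < A -> A < B ->
  exists2 c : R, 0 < c & forall (n : nat) (x : R), supp mu x ->
    ((c * q ^- n)%:E * mu (ball x (B * lambda ^+ n)) <= mu (ball x (A * lambda ^+ n)))%E.

Definition almost_doubling : Prop := forall eps : R, 0 < eps -> exists2 C : R, 0 < C &
  forall r x : R, 0 < r -> r < 1 -> supp mu x ->
    ((C * r `^ eps)%:E * mu (ball x (2 * r)) <= mu (ball x r))%E.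

(* Apply the definition of [qA_H delta] at scales [r = A lambda ^+ n] and
   [r `^ (1 + delta)^-1], the latter exceeding [B lambda ^+ n] for large [n];
   finitely many [n] remain, for which the masses are bounded below. *)
Lemma subexponential_doubling_of_qA_dim : (qA_dim mu < +oo)%E -> subexponential_doubling.
Proof.
move=> /qA_exponent_of_dim[D D0 exponent] q A B q1 A0 AB.
have l0 := min_ratio_gt0 S; have l1 := min_ratio_lt1 S.
have lnl : 0 < - ln lambda by rewrite oppr_gt0 ln_lt0// l0.
have lnq : 0 < ln q by rewrite ln_gt0.
pose delta := ln q / (D * - ln lambda).
have d0 : 0 < delta by rewrite divr_gt0// mulr_gt0.
have [s sD [C1 [C2 [C10 C20 bound]]]] := exponent _ d0.
have B0 : 0 < B by lra.
(* For [lambda ^+ n <= t0] the three entries give, in order, [r <= 1], [rho <= C1] and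
   [B * lambda ^+ n <= rho]. *)
pose t0 := Num.min (A^-1) (Num.min (C1 `^ (1 + delta) / A) ((A / B `^ (1 + delta)) `^ delta^-1)).
have t00 : 0 < t0.
  by rewrite !lt_min invr_gt0 A0 divr_gt0 ?powR_gt0// divr_gt0// powR_gt0.
have [e lower] := mass_ball_lower S_attractor p_gt0 mu_self_similar mu_supp.
pose t1 := Num.min (A * t0) 1.
have t10 : 0 < t1 by rewrite lt_min mulr_gt0//=.
(* The first entry serves the scales [lambda ^+ n <= t0]; the second serves the larger ones, where
   the small ball contains the ball of radius [t1]. *)
pose c := Num.min (A `^ (delta * D) / C2) ((lambda * t1) ^+ e).
have c0 : 0 < c by rewrite lt_min divr_gt0 ?powR_gt0//= exprn_gt0// mulr_gt0.
exists c => // n x xs; have /(supp_unit mu_supp) x01 := xs.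
rewrite mu_ball_le.
have q0 : 0 < q ^+ n by rewrite exprn_gt0//; lra.
have qn1 : 1 <= q ^+ n by rewrite exprn_ege1// ltW.
have u0 : 0 < lambda ^+ n by rewrite exprn_gt0.
have [large|small] := ltP t0 (lambda ^+ n).
  apply: (@le_trans _ _ ((lambda * t1) ^+ e)).
    rewrite -[leRHS]mulr1 ler_pM ?mass_ge0 ?mass_le1 ?mulr_ge0 ?invr_ge0 ?(ltW c0) ?(ltW q0)//.
      rewrite -[leRHS]mulr1 ler_pM ?invr_ge0 ?(ltW c0) ?(ltW q0)//; last by rewrite invf_le1.
      by rewrite ge_min lexx orbT.
    exact: measurable_ball.
  have t11 : t1 <= 1 by rewrite ge_min lexx orbT.
  have lt1 : lambda * t1 <= 1 by nra.
  rewrite (le_trans (lower x t1 x01 t10 lt1))// le_mass_ball// ge_min.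
  by rewrite ler_pM2l// (ltW large).
move: small; rewrite !le_min => /and3P[uA uC uB].
set r := A * lambda ^+ n.
have r0 : 0 < r by rewrite mulr_gt0.
have r1 : r <= 1 by rewrite /r mulrC -ler_pdivlMr// mul1r.
have r01 : 0 < r <= 1 by rewrite r0.
have d1 : 0 < 1 + delta by lra.
pose rho := r `^ (1 + delta)^-1.
have rho0 : 0 < rho by rewrite powR_gt0.
have rhor : rho `^ (1 + delta) = r by rewrite -powRrM mulVf ?gt_eqF// powRr1 ?ltW.
have root_le y : 0 < y -> y `^ (1 + delta) <= r -> y <= rho.
  move=> y0 yr.
  rewrite -[leLHS](@powR_invK _ _ (1 + delta)) ?gt_eqF ?(ltW y0)//.
  by rewrite ge0_ler_powR ?nnegrE ?powR_ge0 ?invr_ge0 ?(ltW d1) ?(ltW r0).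
have r_rho : r <= rho by rewrite ger1_powR// invf_le1//; lra.
have rhoC1 : rho <= C1.
  rewrite -[leRHS](@powR_invK _ _ (1 + delta)) ?gt_eqF ?(ltW C10)//.
  rewrite ge0_ler_powR ?nnegrE ?powR_ge0 ?invr_ge0 ?(ltW d1) ?(ltW r0)//.
  by rewrite /r mulrC -ler_pdivlMr.
have Brho : B * lambda ^+ n <= rho.
  apply: root_le; first exact: mulr_gt0.
  have Bd0 : 0 < B `^ (1 + delta) by rewrite powR_gt0.
  have ud : (lambda ^+ n) `^ delta <= A / B `^ (1 + delta).
    have ABd0 : 0 <= A / B `^ (1 + delta) by rewrite ltW// divr_gt0.
    rewrite -[leRHS](@powR_invK _ _ delta^-1) ?invr_eq0 ?gt_eqF// invrK.
    by rewrite ge0_ler_powR ?nnegrE ?powR_ge0 ?(ltW d0) ?(ltW u0).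
  rewrite powRM ?(ltW B0) ?(ltW u0)// (@gt0_powRD _ (lambda ^+ n))// powRr1 ?(ltW u0)//.
  rewrite mulrCA mulrC /r ler_pM2r// mulrC -ler_pdivlMr//.
have fr0 : 0 < mass (ball x r) by exact: mass_ball_gt0.
have ratio_le : mass (ball x rho) <= C2 * (rho / r) `^ s * mass (ball x r).
  have := bound r rho r0; rewrite rhor => /(_ (lexx _) r_rho rhoC1).
  rewrite -ler_pdivrMr// -lee_fin; apply: le_trans.
  by apply: ereal_sup_ubound; exists x.
have qE : lambda `^ (- (delta * D)) = q.
  have e1 : - (delta * D) * ln lambda = ln q.
    rewrite /delta; field; apply/andP; split; lra.
  by rewrite /powR gt_eqF// e1 lnK// posrE; lra.
have gap : (rho / r) `^ s <= A `^ (- (delta * D)) * q ^+ n.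
  apply: (@le_trans _ _ ((rho / r) `^ D)).
    by rewrite ler_powR// ler_pdivlMr// mul1r.
  have -> : rho / r = r `^ (- (delta / (1 + delta))).
    rewrite -(powR_inv1 (ltW r0)) /rho -gt0_powRD//.
    by congr (_ `^ _); field; rewrite gt_eqF.
  rewrite -powRrM -qE -powR_mulrn ?powR_ge0// powRAC powR_mulrn ?(ltW l0)//.
  rewrite -powRM ?(ltW A0) ?(ltW u0)// ger_powR// mulNr lerN2.
  have dD0 : 0 <= delta * D by rewrite ltW// mulr_gt0.
  by rewrite mulrAC ler_pdivrMr// ler_peMr//; lra.
apply: (@le_trans _ _ (c * q ^- n * mass (ball x rho))).
  rewrite ler_wpM2l ?mulr_ge0 ?invr_ge0 ?(ltW c0) ?(ltW q0)//.
  exact: le_mass_ball.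
apply: (@le_trans _ _ (c * q ^- n * (C2 * (A `^ (- (delta * D)) * q ^+ n) * mass (ball x r)))).
  rewrite ler_wpM2l ?mulr_ge0 ?invr_ge0 ?(ltW c0) ?(ltW q0)//.
  by rewrite (le_trans ratio_le)// ler_wpM2r ?(ltW fr0)// ler_wpM2l// ltW.
have AdD : 0 < A `^ (delta * D) by rewrite powR_gt0.
rewrite powRN (_ : _ * _ = c * (C2 / A `^ (delta * D)) * mass (ball x r)); last first.
  by field; rewrite !gt_eqF.
rewrite -[leRHS]mul1r ler_wpM2r ?(ltW fr0)//.
apply: (@le_trans _ _ (A `^ (delta * D) / C2 * (C2 / A `^ (delta * D)))).
  by rewrite ler_wpM2r ?divr_ge0 ?(ltW C20) ?(ltW AdD)// ge_min lexx.
by rewrite mulrA divfK ?gt_eqF// divff// gt_eqF.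
Qed.

(** With [q = lambda]^ (- eps)[the factor]q ^- n[equals](lambda ^+ n) [^ eps]. Taking [A = lambda]
    and [B = 2] absorbs the rounding of [r] between consecutive powers of [lambda]. *)
Lemma almost_doubling_of_subexponential : subexponential_doubling -> almost_doubling.
Proof.
move=> sub eps eps0.
have l0 := min_ratio_gt0 S; have l1 := min_ratio_lt1 S.
pose q := lambda `^ (- eps).
have q1 : 1 < q.
  rewrite /q /powR gt_eqF// -expR0 ltr_expR mulNr oppr_gt0 pmulr_rlt0//.
  by rewrite ln_lt0// l0.
have [c c0 bound] := sub q lambda 2 q1 l0 ltac:(lra).
exists c => // r x r0 r1 xs.
have [n [nr rn]] := exprn_bracket l0 l1 r0 (ltW r1).
have := bound n x xs; rewrite !mu_ball_le => bnd.
have q0 : 0 < q ^+ n by rewrite exprn_gt0//; lra.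
have cq0 : 0 <= c * q ^- n by rewrite divr_ge0// ltW.
apply: (@le_trans _ _ (c * q ^- n * mass (ball x (2 * lambda ^+ n)))); last first.
  by rewrite (le_trans bnd)// le_mass_ball// -exprS ltW.
apply: ler_pM; rewrite ?mass_ge0 ?mulr_ge0 ?powR_ge0 ?(ltW c0)//; last first.
  by apply: le_mass_ball; rewrite ler_pM2l.
rewrite ler_pM2l//.
have -> : q ^- n = (lambda ^+ n) `^ eps.
  rewrite -powR_mulrn ?powR_ge0// -powRN /q -powRrM mulrNN powRrM powRAC.
  by rewrite powR_mulrn ?ltW.
by rewrite ge0_ler_powR ?nnegrE ?exprn_ge0 ?(ltW eps0) ?(ltW r0) ?(ltW l0).
Qed.

(** Each of the [K] descent steps costs [(rho / r) ^+ s] up to a constant, and all the doubling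
    losses together cost one further factor [rho / r]. The exponent [s * K + 1] is therefore the
    same for every [delta]. *)
Lemma qA_dim_of_almost_doubling :
  weak_separation S -> almost_doubling -> (qA_dim mu < +oo)%E.
Proof.
move=> S_wsc almost.
have [K [s descent]] := mass_ball_descent S_attractor p_gt0 mu_self_similar mu_supp S_wsc.
have l0 := min_ratio_gt0 S; have l1 := min_ratio_lt1 S.
apply: (@le_lt_trans _ _ ((s * K)%:R + 1)%:E); last exact: ltry.
apply: qA_dim_le => delta d0.
have d1 : 0 < 1 + delta by lra.
have K1 : 0 < K.+1%:R :> R by [].
(* Then [K.+1] losses of [r]^ (- eps)[multiply to]r [^ (1 + delta)^-1 / r], which is at most
   [rho / r]. *)
pose eps := delta / (1 + delta) / K.+1%:R.
have eps0 : 0 < eps by rewrite !divr_gt0.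
have [C C0 doubling] := almost eps eps0.
pose C' := Num.min C 1.
have C'0 : 0 < C' by rewrite lt_min C0/=.
pose C2 := (K%:R / (lambda ^+ 2) ^+ s / C') ^+ K + 1.
have C20 : 0 < C2.
  by rewrite ltr_wpDl// exprn_ge0// divr_ge0 ?(ltW C'0)// divr_ge0// !exprn_ge0 ?(ltW l0).
(* The threshold [lambda] for [rho] ensures [n >= 1], as the weak separation condition requires. *)
exists lambda, C2; split => // r rho r0 r_rho rho_rho rho_l.
have r_rho' : r <= rho by lra.
have rho0 : 0 < rho by lra.
have [n [nrho rhon]] := exprn_bracket l0 l1 rho0 (le_trans rho_l (ltW l1)).
have n0 : (0 < n)%N by case: n nrho rhon => [|//]; rewrite expr1; lra.
set R0 := lambda ^+ n in rhon.
have R00 : 0 < R0 by rewrite exprn_gt0.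
have R01 : R0 < 1 by rewrite exprn_ilt1 ?(ltW l0)// -lt0n.
apply: ub_ereal_sup => _ [x xs <-]; rewrite lee_fin.
have /(supp_unit mu_supp) x01 := xs.
have fr0 : 0 < mass (ball x r) by exact: mass_ball_gt0.
rewrite ler_pdivrMr//.
have r01 : 0 < r <= 1 by rewrite r0; lra.
pose Q := C'^-1 * r `^ (- eps).
have re1 : 1 <= r `^ (- eps).
  by rewrite -(powRr0 r) ger_powR//; lra.
have Q1 : 1 <= Q.
  by rewrite /Q mulr_ege1// invf_ge1// /C' ge_min lexx orbT.
have double t : r <= t -> t <= R0 -> mass (ball x (2 * t)) <= Q * mass (ball x t).
  move=> rt tR; have tt0 : 0 < t by lra.
  have := doubling t x tt0 ltac:(lra) xs; rewrite mu_ball_le.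
  have Ct0 : 0 < C * t `^ eps by rewrite mulr_gt0// powR_gt0.
  rewrite mulrC -ler_pdivlMr// [leRHS]mulrC => /le_trans; apply.
  rewrite ler_wpM2r ?mass_ge0// invfM /Q powRN ler_pM ?invr_ge0 ?powR_ge0 ?(ltW C0)//.
    by rewrite lef_pV2 ?posrE// /C' ge_min lexx.
  by rewrite lef_pV2 ?posrE ?powR_gt0// ge0_ler_powR ?nnegrE ?(ltW r0) ?(ltW tt0) ?(ltW eps0).
have := descent n x r Q n0 r0 (le_trans r_rho' rhon) Q1 double.
move=> /(le_trans (le_mass_ball mu x rhon)) /le_trans; apply.
rewrite ler_wpM2r ?(ltW fr0)//.
have rr0 : 0 < rho / r by rewrite divr_gt0.
have eps_gap : r `^ (- eps) ^+ K <= rho / r.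
  have root : r `^ (1 + delta)^-1 <= rho.
    rewrite -[leRHS](@powR_invK _ _ (1 + delta)) ?gt_eqF ?(ltW rho0)//.
    by rewrite ge0_ler_powR ?nnegrE ?powR_ge0 ?invr_ge0 ?(ltW d1) ?(ltW r0).
  apply: (@le_trans _ _ (r `^ (- eps) ^+ K.+1)).
    by rewrite exprS ler_peMl// exprn_ge0// powR_ge0.
  apply: (@le_trans _ _ (r `^ (1 + delta)^-1 / r)); last by rewrite ler_pM2r ?invr_gt0.
  rewrite -powR_mulrn ?powR_ge0// -powRrM -(powR_inv1 (ltW r0)) -gt0_powRD//.
  rewrite (_ : - eps * _ = (1 + delta)^-1 + -1)// /eps; field.
  by rewrite !gt_eqF.
(* One [lambda] comes from the lower mass bound, the other from [R0 < rho / lambda]. *)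
have u_le : ((lambda * (r / R0)) ^+ s)^-1 <= (rho / r) ^+ s / (lambda ^+ 2) ^+ s.
  have scale0 : 0 < lambda * (r / R0) by rewrite mulr_gt0// divr_gt0.
  have scale0' : 0 < lambda * (r / (rho / lambda)) by rewrite mulr_gt0// !divr_gt0.
  have key : (lambda * (r / R0))^-1 <= rho / r / lambda ^+ 2.
    rewrite (_ : _ / _ ^+ 2 = (lambda * (r / (rho / lambda)))^-1); last first.
      by field; rewrite !gt_eqF.
    rewrite lef_pV2 ?posrE// ler_pM2l// ler_pM2l// lef_pV2 ?posrE ?divr_gt0//.
    by rewrite ler_pdivlMr// mulrC -exprS ltW.
  rewrite -exprVn -expr_div_n lerXn2r ?nnegrE// ?(le_trans _ key)// invr_ge0 ltW//.
rewrite gt0_powRD// powRr1 ?(ltW rr0)// powR_mulrn ?(ltW rr0)//.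
apply: (@le_trans _ _ ((K%:R * ((rho / r) ^+ s / (lambda ^+ 2) ^+ s) * Q) ^+ K)).
  have Q0 : 0 <= Q by lra.
  have W0 : 0 <= K%:R / (lambda * (r / R0)) ^+ s * Q.
    by rewrite mulr_ge0// divr_ge0// exprn_ge0// mulr_ge0 ?divr_ge0 ?(ltW l0) ?(ltW r0) ?(ltW R00).
  have W_le : K%:R / (lambda * (r / R0)) ^+ s * Q <=
      K%:R * ((rho / r) ^+ s / (lambda ^+ 2) ^+ s) * Q by rewrite ler_wpM2r// ler_wpM2l.
  by rewrite lerXn2r ?nnegrE// (le_trans W0 W_le).
rewrite /Q /C2; set b := _ / C'.
rewrite (_ : _ * (_ * _) = b * ((rho / r) ^+ s * r `^ (- eps))); last by rewrite /b; ring.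
have b0 : 0 <= b by rewrite !mulr_ge0 ?invr_ge0 ?(ltW C'0) ?exprn_ge0 ?(ltW l0).
have gap : (rho / r) ^+ (s * K) * r `^ (- eps) ^+ K <= (rho / r) ^+ (s * K) * (rho / r).
  by rewrite ler_wpM2l// exprn_ge0// ltW.
rewrite (exprMn K b) (exprMn K (_ ^+ s)) -exprM ler_pM ?exprn_ge0//.
- by rewrite mulr_ge0 ?exprn_ge0 ?powR_ge0 ?(ltW rr0).
- by rewrite lerDl.
Qed.

End characterization.

Theorem corollary4p6 (R : realType) (k : nat) (S : ifs R k)
    (S_attractor : is_attractor S `[0, 1]%classic)
    (S_first : ifs_map S ord0 0 = 0)
    (S_last : ifs_map S ord_max 1 = 1)
    (p : 'I_k.+1 -> R)
    (p_gt0 : forall j, 0 < p j)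
    (p_sum : \sum_(j < k.+1) p j = 1)
    (mu : probability (measurableTypeR R) R)
    (mu_self_similar : is_self_similar S p mu)
    (mu_supp : supp mu = `[0, 1]%classic)
    (S_wsc : weak_separation S) :
  ((qA_dim mu < +oo)%E <->
     forall q A B : R, 1 < q -> 0 < A -> A < B ->
     exists2 c : R, 0 < c &
       forall (n : nat) (x : R), supp mu x ->
         ((c * q ^- n)%:E * mu (ball x (B * min_ratio S ^+ n))
            <= mu (ball x (A * min_ratio S ^+ n)))%E)
  /\
  ((qA_dim mu < +oo)%E <->
     forall eps : R, 0 < eps ->
     exists2 C : R, 0 < C &
       forall r x : R, 0 < r -> r < 1 -> supp mu x ->
         ((C * r `^ eps)%:E * mu (ball x (2 * r)) <= mu (ball x r))%E).
Proof.
have to_sub :=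
  @subexponential_doubling_of_qA_dim R k S p mu S_attractor p_gt0 mu_self_similar mu_supp.
have to_almost := @almost_doubling_of_subexponential R k S mu.
have to_dim :=
  @qA_dim_of_almost_doubling R k S p mu S_attractor p_gt0 mu_self_similar mu_supp S_wsc.
split; split.
- exact: to_sub.
- by move=> /to_almost/to_dim.
- by move=> /to_sub/to_almost.
- exact: to_dim.
Qed.
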